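(* Let $\Gamma=\{1,\dots,m\}$, let $f_\gamma:\mathbb{R}^n\to\mathbb{R}^n$ ($\gamma\in\Gamma$) be continuous, write $f(\xi,\gamma)=f_\gamma(\xi)$, and consider the switched system $\dot x=f(x,\sigma)$. Let $\chi$ be a closed covering of $\mathbb{R}^n$ and let $V:\Omega\times\Gamma\to\mathbb{R}$, with $\Omega$ an open subset of $\mathbb{R}^n$, be continuous. Suppose that $(x,\sigma)$ is a trajectory belonging to $\mathcal{T}_V\cap\mathcal{T}[\chi]\cap\mathcal{T}_a[\tau_D,N_0]$ (with $\tau_D>0$, $N_0\in\mathbb{N}$) such that for some compact subset $B\subset\Omega$, $x(t)\in B$ for all $t\ge0$. Let $M\subseteq\mathbb{R}^n\times\Gamma$ be the largest weakly-invariant set with respect to $\mathcal{T}_V^*\cap\mathcal{T}[\chi]\cap\mathcal{T}_a[\tau_D,N_0]$ contained in $\Omega\times\Gamma$. Then $x(t)$ converges to $\pi_1(M)$ as $t\to\infty$, where $\pi_1:\mathbb{R}^n\times\Gamma\to\mathbb{R}^n$ is the projection onto the first component.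
   Context: Notation: $\mathbb{R}_+=[0,\infty)$, $\mathbb{N}$ is the set of positive integers. ''$x(t)$ converges to a set $A$'' means $d(x(t),A)=\inf_{a\in A}|x(t)-a|\to0$ as $t\to\infty$. Switched system. $\Gamma$ carries the discrete metric. A switching signal is a piecewise constant, right-continuous function $\sigma:\mathbb{R}_+\to\Gamma$. Its switching times are $t_0=0$ and its consecutive discontinuities $t_1<t_2<\cdots$ (finitely many, or infinitely many tending to $\infty$). A solution of $\dot x=f(x,\sigma)$ corresponding to $\sigma$ is a (continuous) piecewise smooth curve $x:\mathcal{I}\to\mathbb{R}^n$, $\mathcal{I}=[0,T)$ or $[0,T]$, $0<T\le\infty$, with $\dot x(t)=f(x(t),\sigma(t))$ for all $t\in(t_i,t_{i+1})\cap\mathcal{I}$ and all $i$ (with $t_{i+1}=\infty$ if $t_i$ is the last switching time). A trajectory is a pair $(x,\sigma)$ with $x$ a solution corresponding to $\sigma$; it is maximal if $x$ is a maximal (non-extendable) solution, and its domain is then $\mathcal{I}_{(x,\sigma)}=[0,t_{(x,\sigma)})$. $\mathcal{T}$ is the set of all maximal trajectories. A closed covering of $\mathbb{R}^n$ is a family $\chi=\{\chi_\gamma:\gamma\in\Gamma\}$ of closed sets with $\bigcup_\gamma\chi_\gamma=\mathbb{R}^n$. $\mathcal{T}[\chi]$ is the set of $(x,\sigma)\in\mathcal{T}$ with $x(t)\in\chi_{\sigma(t)}$ for all $t\in\mathcal{I}_{(x,\sigma)}$. Average dwell-time. $\sigma$ has average dwell-time $\tau_D>0$ and chatter bound $N_0\in\mathbb{N}$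 if the number of switching times of $\sigma$ in any open finite interval $(\tau_1,\tau_2)\subset\mathbb{R}_+$ is at most $N_0+(\tau_2-\tau_1)/\tau_D$. $\mathcal{S}_a[\tau_D,N_0]$ is the set of such signals and $\mathcal{T}_a[\tau_D,N_0]$ the set of $(x,\sigma)\in\mathcal{T}$ with $\sigma\in\mathcal{S}_a[\tau_D,N_0]$. Families associated with $V$. $\mathcal{T}_V$ is the set of $(x,\sigma)\in\mathcal{T}$ such that $x(t)\in\Omega$ for all $t\in\mathcal{I}_{(x,\sigma)}$ and $V(x(t),\sigma(t))\ge V(x(t'),\sigma(t'))$ whenever $t\le t'$ in $\mathcal{I}_{(x,\sigma)}$ and $\sigma(t)=\sigma(t')$. $\mathcal{T}_V^*$ is the set of $(x,\sigma)\in\mathcal{T}_V$ such that $\sigma(t)=\sigma(t')$ implies $V(x(t),\sigma(t))=V(x(t'),\sigma(t'))$, for $t,t'\in\mathcal{I}_{(x,\sigma)}$. Weak invariance. For a family $\mathcal{T}^*$ of maximal trajectories, a nonempty $M\subseteq\mathbb{R}^n\times\Gamma$ is weakly-invariant with respect to $\mathcal{T}^*$ if for each $(\xi,\gamma)\in M$ there is $(x,\sigma)\in\mathcal{T}^*$ with $x(0)=\xi$, $\sigma(0)=\gamma$ and $(x(t),\sigma(t))\in M$ for all $t\in\mathcal{I}_{(x,\sigma)}$. *)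

(* Defs.v *)
From HB Require Import structures.
From mathcomp Require Import all_boot all_order all_algebra.
From mathcomp Require Import all_classical all_reals all_analysis.
Set Implicit Arguments.
Unset Strict Implicit.
Unset Printing Implicit Defensive.
Import Order.TTheory GRing.Theory Num.Theory numFieldNormedType.Exports.
Local Open Scope classical_set_scope.
Local Open Scope ring_scope.

(** Signals and curves are total functions on [R]; only their values on
    [0, +oo), respectively on the domain of the curve, are ever used. *)

Section SwitchedSystems.
Context {R : realType} {n m : nat}.
Implicit Types (I J P : set R) (x y : R -> 'rV[R]_n) (s : R -> 'I_m).

Definition locally_finite P := forall a b : R, finite_set (P `&` `[a, b]).

(** ['I_m] is discrete, so right-continuity at [t] means being constant on
    some [t, t + e). *)
Definition switching_signal s :=
  (exists2 P, locally_finite P &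
     forall a b, 0 <= a -> (forall t, P t -> t \notin `]a, b[) ->
       {in `]a, b[ &, forall t t', s t = s t'}) /\
  (forall t : R, 0 <= t -> \forall u \near t^'+, s u = s t).

Definition switching_times s : set R :=
  0 |` [set t : R | 0 < t /\ ~ \forall u \near t, s u = s t].

(** [0, T) with 0 < T <= +oo, or [0, T] with 0 < T < +oo. *)
Definition time_domain I :=
  (exists2 T : \bar R, (0 < T)%E & I = [set t : R | 0 <= t /\ (t%:E < T)%E]) \/
  (exists2 T : R, 0 < T & I = `[0, T]%classic).

(** Derivative relative to [I]: the usual one at interior points of [I], the
    one-sided one at an end point belonging to [I]. *)
Definition derivative_within I x (t : R) (v : 'rV[R]_n) :=
  (u - t)^-1 *: (x u - x t) @[u --> within I t^'] --> v.

(** Piecewise smooth means piecewise C^1: the [f_g] are only continuous, so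
    solutions have no higher regularity in general. *)
Definition piecewise_smooth I x :=
  {within I, continuous x} /\
  exists P (v : R -> 'rV[R]_n), [/\ locally_finite P,
    forall t, (I `\` P) t -> derivative_within I x t (v t),
    {within I `\` P, continuous v} &
    forall t, I t ->
      (exists l : 'rV[R]_n, v u @[u --> within (I `\` P) t^'-] --> l) /\
      (exists l : 'rV[R]_n, v u @[u --> within (I `\` P) t^'+] --> l)].

(** The switching times being locally finite, the union of the intervals
    (t_i, t_(i+1)) is the complement in [0, +oo) of the set of switching
    times. *)
Definition solution (f : 'I_m -> 'rV[R]_n -> 'rV[R]_n) s I x :=
  [/\ time_domain I, piecewise_smooth I x &
      forall t, I t -> ~ switching_times s t ->
        derivative_within I x t (f (s t) (x t))].

Definition maximal_solution f s I x :=
  solution f s I x /\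
  forall J y, solution f s J y -> I `<=` J -> (forall t, I t -> y t = x t) ->
    J = I.

(** Curves being total functions, the domain is part of the data. *)
Record trajectory := Trajectory {
  curve : R -> 'rV[R]_n;
  signal : R -> 'I_m;
  domain : set R }.

Definition maximal_trajectories f : set trajectory :=
  [set p | switching_signal (signal p) /\
           maximal_solution f (signal p) (domain p) (curve p)].

Definition closed_covering (chi : 'I_m -> set 'rV[R]_n) :=
  (forall g, closed (chi g)) /\ \bigcup_g chi g = setT.

Definition trajectories_in f (chi : 'I_m -> set 'rV[R]_n) : set trajectory :=
  [set p | maximal_trajectories f p /\
           forall t, domain p t -> chi (signal p t) (curve p t)].

Definition average_dwell_time (tauD : R) (N0 : nat) s :=
  forall a b, 0 <= a -> a < b ->
    exists2 k : nat, (switching_times s `&` `]a, b[ #= `I_k)%card &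
      k%:R <= N0%:R + (b - a) / tauD.

Definition dwell_time_trajectories f (tauD : R) (N0 : nat) : set trajectory :=
  [set p | maximal_trajectories f p /\ average_dwell_time tauD N0 (signal p)].

(** [V xi g] is relevant for [xi] in [Omega] only. *)
Definition trajectories_V f (Omega : set 'rV[R]_n) (V : 'rV[R]_n -> 'I_m -> R) :
    set trajectory :=
  [set p | [/\ maximal_trajectories f p,
    forall t, domain p t -> Omega (curve p t) &
    forall t t', domain p t -> domain p t' -> t <= t' ->
      signal p t = signal p t' ->
      V (curve p t') (signal p t') <= V (curve p t) (signal p t)]].

Definition trajectories_V_star f (Omega : set 'rV[R]_n)
    (V : 'rV[R]_n -> 'I_m -> R) : set trajectory :=
  [set p | trajectories_V f Omega V p /\
    forall t t', domain p t -> domain p t' -> signal p t = signal p t' ->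
      V (curve p t) (signal p t) = V (curve p t') (signal p t')].

Definition weakly_invariant (TT : set trajectory)
    (M : set ('rV[R]_n * 'I_m)) :=
  M !=set0 /\
  forall xi g, M (xi, g) ->
    exists2 p, TT p & [/\ curve p 0 = xi, signal p 0 = g &
      forall t, domain p t -> M (curve p t, signal p t)].

Definition largest_weakly_invariant (TT : set trajectory)
    (D M : set ('rV[R]_n * 'I_m)) :=
  [/\ weakly_invariant TT M, M `<=` D &
      forall M', weakly_invariant TT M' -> M' `<=` D -> M' `<=` M].

(** The library's norm on ['rV[R]_n] is the sup norm. *)
Definition euclidean_norm (u : 'rV[R]_n) : R :=
  Num.sqrt (\sum_(i < n) u ord0 i ^+ 2).

(** Extended-real valued, so that the distance to the empty set is [+oo]. *)
Definition distance_to (xi : 'rV[R]_n) (A : set 'rV[R]_n) : \bar R :=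
  ereal_inf [set (euclidean_norm (xi - a))%:E | a in A].

Definition converges_to_set x (A : set 'rV[R]_n) :=
  distance_to (x t) A @[t --> +oo] --> 0%E.

End SwitchedSystems.
Arguments trajectory : clear implicits.

(* Main.v *)
Require Import Defs.
From HB Require Import structures.
From mathcomp Require Import all_boot all_order all_algebra lra.
From mathcomp Require Import all_classical all_reals all_analysis.
Set Implicit Arguments.
Unset Strict Implicit.
Unset Printing Implicit Defensive.
Import Order.TTheory GRing.Theory Num.Theory numFieldNormedType.Exports.
Local Open Scope classical_set_scope.
Local Open Scope ring_scope.

(** Let [U] be an ultrafilter on the line finer than the neighbourhoods of
    +oo.  Since [x] stays in a compact set and there are finitely many modes,
    all the translates [x (t + r)] and [sigma (t + r)] converge along [t --> U]
    simultaneously in [r], with no extraction of subsequences.  The limits of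
    switching times of the translates form a locally finite set, by the average
    dwell-time bound; away from it the translated signals are eventually
    constant near [r], so there a mean value inequality shows that the limit
    curve [y] solves the limit equation.  The limit signal, made
    right-continuous, inherits the dwell-time bound, and [V] is constant along
    the limit on each mode, because the monotonicity of [V] can be used for two
    independent times tending to infinity.  The range of [(y, s)] over
    [0, +oo) is weakly invariant since translating [U] translates the limit.
    Were [x] not to converge to the projection of the union of all weakly
    invariant sets, some [U] would contain the set of times at which [x] is
    [e]-far from it, contradicting [lim_U x = y 0]. *)

(** * Real induction and the mean value inequality *)

Section RealLine.
Variable R : realType.
Implicit Types (a b c d e t u : R) (P A : set R).

Lemma exists_lt2 a b : 0 < a -> 0 < b -> exists r, [/\ 0 < r, r < a & r < b].
Proof.
move=> a0 b0; have [ab|ba] := leP a b; [exists (a / 2)|exists (b / 2)];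
  by split; lra.
Qed.

Lemma near_distP t P :
  (\forall u \near t, P u) <-> exists2 d, 0 < d & forall u, `|u - t| < d -> P u.
Proof.
split.
  move=> /nbhs_normP [d /= d0 H]; exists d => // u ud; apply: H.
  by rewrite /ball_ /= distrC.
move=> [d d0 H]; apply/nbhs_normP; exists d => //= u; rewrite /ball_ /= distrC.
exact: H.
Qed.

Lemma near_rightP t P :
  (\forall u \near t^'+, P u) <->
  exists2 d, 0 < d & forall u, t < u < t + d -> P u.
Proof.
split.
  move=> /near_distP [d d0 H]; exists d => // u /andP[tu ud].
  by apply: H => //; rewrite ger0_norm; lra.
move=> [d d0 H]; apply/near_distP; exists d => // u ud tu; apply: H.
by move: ud; rewrite ger0_norm; lra.
Qed.

Lemma near_leftP t P :
  (\forall u \near t^'-, P u) <->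
  exists2 d, 0 < d & forall u, t - d < u < t -> P u.
Proof.
split.
  move=> /near_distP [d d0 H]; exists d => // u /andP[tu ud].
  by apply: H => //; rewrite ler0_norm; lra.
move=> [d d0 H]; apply/near_distP; exists d => // u ud tu; apply: H.
by move: ud; rewrite ler0_norm; lra.
Qed.

(** Real induction: the supremum of the [c] in [[a, b]] with [Q a c] is attained by the left half of
    the local hypothesis and equals [b] by the right half. *)
Lemma interval_chain (Q : R -> R -> Prop) a b : a <= b ->
  (forall c d e, Q c d -> Q d e -> Q c e) ->
  (forall t, a <= t <= b -> exists2 d, 0 < d &
     (forall u, a <= u -> t - d < u <= t -> Q u t) /\
     (forall u, u <= b -> t <= u < t + d -> Q t u)) ->
  Q a b.
Proof.
move=> ab trQ locQ.
have Qaa : Q a a.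
  have [|d d0 [Hl _]] := locQ a; first by rewrite lexx.
  by apply: Hl; lra.
pose S := [set c | a <= c <= b /\ Q a c].
have Sa : S a by split; rewrite ?lexx.
have ubS : has_ubound S by exists b => c [/andP[]].
have supS : has_sup S by split => //; exists a.
have asup : a <= sup S by exact: ub_le_sup.
have supb : sup S <= b by apply: ge_sup; [exists a|move=> c [/andP[]]].
have [|d d0 [Hl Hr]] := locQ (sup S); first by rewrite asup.
have [c [/andP[ac cb] Qac] cS] := sup_adherent d0 supS.
have csup : c <= sup S by apply: ub_le_sup => //; split=> //; rewrite ac.
have Qs : Q a (sup S) by apply: trQ Qac (Hl _ _ _) => //; rewrite cS.
have [sb|] := ltP (sup S) b; last first.
  by move=> bs; have <- : sup S = b by apply/eqP; rewrite eq_le supb.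
pose e := Num.min b (sup S + d / 2).
have eb : e <= b by rewrite /e ge_min lexx.
have se : sup S < e by rewrite /e lt_min; apply/andP; split; lra.
have ed : e < sup S + d by rewrite /e gt_min; apply/orP; right; lra.
have : S e.
  split; first by apply/andP; split; lra.
  by apply: trQ Qs (Hr _ _ _) => //; apply/andP; split; lra.
by move/(ub_le_sup ubS); lra.
Qed.

Lemma locally_constant_interval (T : Type) (s : R -> T) a b :
  (forall t, a < t < b -> \forall u \near t, s u = s t) ->
  forall t u, a < t < b -> a < u < b -> s t = s u.
Proof.
move=> loc.
have main t u : a < t < b -> a < u < b -> t <= u -> s t = s u.
  move=> tab uab tu; apply: (@interval_chain (fun c d => s c = s d)) => //.
    by move=> c d e -> ->.
  move=> v vtu; have /near_distP[d d0 H] : \forall u \near v, s u = s v.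
    by apply: loc; lra.
  exists d => //; split=> w wab wv; [apply: H|symmetry; apply: H].
    by rewrite ler0_norm; lra.
  by rewrite ger0_norm; lra.
move=> t u tab uab; have [tu|/ltW ut] := leP t u; first exact: main.
by symmetry; exact: main.
Qed.

Lemma locally_finite_avoid P t : locally_finite P ->
  exists2 d, 0 < d & forall u, `|u - t| < d -> u != t -> ~ P u.
Proof.
move=> /(_ (t - 1) (t + 1)) finP.
have clP : closed ((P `&` `[t - 1, t + 1]) `\ t).
  apply: (accessible_finite_set_closed.1 _ _ (finite_setD _ finP)).
  exact/hausdorff_accessible/Rhausdorff.
have /near_distP[d d0 H] :
    \forall u \near t, (~` ((P `&` `[t - 1, t + 1]) `\ t)) u.
  by apply: open_nbhs_nbhs; split; [exact: closed_openC|case=> _; apply].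
(* The bound [1] keeps [u] in the window on which [P] is known to be finite. *)
exists (Num.min d 1); first by rewrite lt_min d0 ltr01.
move=> u; rewrite lt_min => /andP[ud]; rewrite ltr_distl => /andP[u1 u2] ut Pu.
apply: (H u ud); split; last exact/eqP.
by split=> //=; rewrite in_itv /=; apply/andP; split; lra.
Qed.

End RealLine.

Section Increments.
Variables (R : realType) (W : normedModType R).
Implicit Types (phi : R -> W) (P : set R) (a b c e t u : R).

Lemma within_itv_distP phi a b t :
  {within `[a, b], continuous phi} -> a <= t <= b -> forall e, 0 < e ->
  exists2 d, 0 < d & forall u, a <= u <= b -> `|u - t| < d ->
    `|phi u - phi t| < e.
Proof.
move=> /subspace_continuousP phic tab e e0.
have /phic/cvgrPdist_lt/(_ e e0) : `[a, b]%classic t by rewrite /= in_itv.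
move=> /near_distP[d d0 H]; exists d => // u uab ud.
by rewrite distrC; apply: H => //=; rewrite in_itv.
Qed.

Lemma increment_le_chain phi (C : R) a b : a <= b ->
  (forall t, a <= t <= b ->
     \forall u \near t, `|phi u - phi t| <= C * `|u - t|) ->
  `|phi b - phi a| <= C * (b - a).
Proof.
move=> ab loc.
apply: (@interval_chain _ (fun c d => `|phi d - phi c| <= C * (d - c))) => //.
  move=> c d e cd de; apply: le_trans (ler_distD (phi d) _ _) _.
  by rewrite (_ : C * (e - c) = C * (e - d) + C * (d - c)) ?lerD//; lra.
move=> t /loc/near_distP[d d0 H]; exists d => //; split=> u _ ut.
  have := H u; rewrite [`|phi u - _|]distrC ler0_norm ?opprB; last lra.
  by apply; lra.
by have := H u; rewrite ger0_norm; [apply; lra|lra].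
Qed.

(** At the endpoints only continuity is available: shrinking [[a, b]] by [r] at each end costs less
    than [e], and [e] is arbitrary. *)
Lemma increment_le_open phi (C : R) a b : 0 <= C -> a < b ->
  {within `[a, b], continuous phi} ->
  (forall t, a < t < b ->
     \forall u \near t, `|phi u - phi t| <= C * `|u - t|) ->
  `|phi b - phi a| <= C * (b - a).
Proof.
move=> C0 ab phic loc; apply/ler_addgt0Pr => e e0.
have e20 : 0 < e / 2 by lra.
have [|d d0 Ha] := within_itv_distP (t := a) phic _ e20; first lra.
have [|d' d'0 Hb] := within_itv_distP (t := b) phic _ e20; first lra.
have [s [s0 sd sd']] := exists_lt2 d0 d'0.
have [|r [r0 rs rab]] := exists_lt2 (a := s) (b := (b - a) / 2) s0; first lra.
have phia : `|phi (a + r) - phi a| < e / 2.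
  by apply: Ha; [lra|rewrite ger0_norm; lra].
have phib : `|phi b - phi (b - r)| < e / 2.
  by rewrite distrC; apply: Hb; [lra|rewrite ler0_norm; lra].
have phim : `|phi (b - r) - phi (a + r)| <= C * (b - r - (a + r)).
  by apply: increment_le_chain => [|t tab]; [lra|apply: loc; lra].
have Cm : C * (b - r - (a + r)) <= C * (b - a) by apply: ler_wpM2l => //; lra.
have := ler_distD (phi (b - r)) (phi b) (phi a).
have := ler_distD (phi (a + r)) (phi (b - r)) (phi a).
by lra.
Qed.

(** Around any [t] the set [P] is met at most at [t] itself, which becomes an endpoint of the
    intervals on either side, where no local bound is required; [interval_chain] glues the
    pieces. *)
Lemma increment_le phi (C : R) P a b : 0 <= C -> a <= b -> locally_finite P ->
  {within `[a, b], continuous phi} ->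
  (forall t, a < t < b -> ~ P t ->
     \forall u \near t, `|phi u - phi t| <= C * `|u - t|) ->
  `|phi b - phi a| <= C * (b - a).
Proof.
move=> C0 ab Pfin phic loc.
have step c e : a <= c -> c <= e -> e <= b ->
    (forall t, c < t < e -> ~ P t) -> `|phi e - phi c| <= C * (e - c).
  move=> ac; rewrite le_eqVlt => /orP[/eqP <- _ _|ce eb Pn].
    by rewrite !subrr normr0 mulr0.
  apply: increment_le_open => // [|t tce].
    apply: continuous_subspaceW phic => u /=; rewrite !in_itv /=; lra.
  by apply: loc; [lra|exact: Pn].
apply: (@interval_chain _ (fun c d => `|phi d - phi c| <= C * (d - c))) => //.
  move=> c d e cd de; apply: le_trans (ler_distD (phi d) _ _) _.
  by rewrite (_ : C * (e - c) = C * (e - d) + C * (d - c)) ?lerD//; lra.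
move=> t tab; have [d d0 H] := locally_finite_avoid t Pfin.
exists d => //; split=> u uab ut; (apply: step; [lra|lra|lra|]) => w wut.
  by apply: H; [rewrite ler0_norm; lra|rewrite lt_eqF; lra].
by apply: H; [rewrite ger0_norm; lra|rewrite gt_eqF; lra].
Qed.

(** Division-free differentiability, so that [u = t] need not be excluded. *)
Definition has_deriv phi t (v : W) := forall e, 0 < e ->
  \forall u \near t, `|phi u - phi t - (u - t) *: v| <= e * `|u - t|.

(** Subtracting the line [u *: v] leaves derivatives [w - v]; the strict margin [e - |w - v|]
    absorbs the error term of [has_deriv], which gives the local bound with constant [e]. *)
Lemma mean_value_inequality phi P (v : W) e a b : 0 <= e -> a <= b ->
  locally_finite P -> {within `[a, b], continuous phi} ->
  (forall t, a < t < b -> ~ P t -> exists2 w, has_deriv phi t w &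
     `|w - v| < e) ->
  `|phi b - phi a - (b - a) *: v| <= e * (b - a).
Proof.
move=> e0 ab Pfin phic der; pose psi u := phi u - u *: v.
rewrite (_ : _ - _ - _ = psi b - psi a); last first.
  by rewrite /psi scalerBl !opprD !opprK addrACA.
apply: (increment_le e0 ab Pfin) => [|t tab Pt].
  by apply: within_continuousB => // u; apply: continuous_subspaceT => {}u;
     apply: cvgZr_tmp.
have [w wder wv] := der t tab Pt.
have ewv : 0 < e - `|w - v| by rewrite subr_gt0.
apply: filterS (wder _ ewv) => u; rewrite mulrBl => H.
rewrite (_ : psi u - psi t = phi u - phi t - (u - t) *: w + (u - t) *: (w - v)).
  by have := ler_normD (phi u - phi t - (u - t) *: w) ((u - t) *: (w - v));
     rewrite normrZ mulrC; lra.
rewrite scalerBr addrA subrK /psi scalerBl !opprD !opprK addrACA.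
by rewrite [- (u *: v) + _]addrC.
Qed.

Lemma within_continuous_lip phi (A : set R) (L : R) :
  (forall t u, A t -> A u -> `|phi u - phi t| <= L * `|u - t|) ->
  {within A, continuous phi}.
Proof.
move=> lip; apply/subspace_continuousP => t At; apply/cvgrPdist_le => e e0.
have L0 : 0 < `|L| + 1 by have := normr_ge0 L; lra.
apply/near_distP; exists (e / (`|L| + 1)); first exact: divr_gt0.
move=> u; rewrite ltr_pdivlMr// => ut Au; rewrite distrC.
apply: le_trans (lip _ _ At Au) _.
apply: le_trans (ltW ut); rewrite mulrC ler_wpM2l//.
by have := ler_norm L; lra.
Qed.

End Increments.

(** * Cardinality bounds through injections, and separation of finitely many points *)

Section Counting.
Variables (R : realType) (T : choiceType) (A : set T).

Lemma card_ge_inj (k j : nat) (e : 'I_j -> T) :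
  (A #= `I_k)%card -> injective e -> (forall i, A (e i)) -> (j <= k)%N.
Proof.
move=> Ak einj eA.
have finA : finite_set A by apply/finite_setP; exists k.
rewrite -(card_fset_set Ak) -[j]card_ord cardE -(size_map e).
apply: uniq_leq_size; first by rewrite map_inj_uniq ?enum_uniq.
by move=> _ /mapP[i _ ->]; rewrite in_fset_set// inE.
Qed.

(** Bounding every finite family suffices: an infinite [A] would contain [Num.bound c] distinct
    points, more than [c]. *)
Lemma card_bounded_inj (c : R) :
  (forall j (e : 'I_j -> T), injective e -> (forall i, A (e i)) ->
     j%:R <= c) ->
  exists2 k : nat, (A #= `I_k)%card & k%:R <= c.
Proof.
move=> H.
have Hseq (s : seq T) : uniq s -> {subset s <= A} -> (size s)%:R <= c.
  move=> us sA; apply: (H _ (tnth (in_tuple s))); first exact/tuple_uniqP.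
  by move=> i; apply/set_mem/sA/mem_tnth.
have c0 : 0 <= c by rewrite -[0]/(0%:R); exact: (Hseq [::]).
have finA : finite_set A.
  apply: contrapT => /(infinite_set_fset (Num.bound c)) [B BA].
  rewrite leqNgt -(ltr_nat R) => /negP; apply.
  apply: le_lt_trans (archi_boundP c0); apply: Hseq => // x xB.
  by rewrite inE; exact: BA.
have /finite_setP[k Ak] := finA; exists k => //; rewrite -(card_fset_set Ak).
by apply: Hseq => [|x]; rewrite ?finmap.fset_uniq// in_fset_set.
Qed.

End Counting.

Section Separation.
Variable R : realType.

(** Each requirement holds for all small [r > 0], and there are finitely many pairs of indices. The
    open balls of radius [r] about the points are then disjoint and inside []a, b[]. *)
Lemma exists_separation (j : nat) (e : 'I_j -> R) (a b : R) : injective e ->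
  (forall i, a < e i < b) ->
  exists2 r, 0 < r & forall i, [/\ a <= e i - r, e i + r <= b &
    forall k, i != k -> 2 * r <= `|e i - e k|].
Proof.
move=> einj eab.
have : \forall r \near (0:R)^'+, forall ik : 'I_j * 'I_j,
    [/\ a <= e ik.1 - r, e ik.1 + r <= b &
     ik.1 != ik.2 -> 2 * r <= `|e ik.1 - e ik.2|].
  apply: filter_forall => -[i k] /=; apply/near_rightP.
  have [ai ib] := andP (eab i).
  have [||r [r0 ra rb]] := @exists_lt2 _ (e i - a) (b - e i); [lra|lra|].
  have [<-|ik] := eqVneq i k.
    by exists r => // u u0; split=> //; lra.
  have [|s [s0 sr sk]] := @exists_lt2 _ _ (`|e i - e k| / 2) r0.
    by rewrite divr_gt0// normr_gt0 subr_eq0; apply: contra ik => /eqP/einj->.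
  by exists s => // u u0; split=> [||_]; lra.
move=> /(filterI (nbhs_right_gt 0)) /filter_ex[r [/= r0 H]].
exists r => // i; have [ai ib _] := H (i, i).
by split=> // k ik; have [_ _] := H (i, k); exact.
Qed.

End Separation.

(** * Limits of translates along an ultrafilter *)

Section UltraLimit.
Variables (R : realType) (U : set_system R).
Hypothesis U_ultra : UltraFilter U.

Lemma ultra_not (P : set R) :
  ~ (\forall t \near U, P t) -> \forall t \near U, ~ P t.
Proof. by move=> nP; have [] := in_ultra_setVsetC P U_ultra. Qed.

(** Otherwise [U] would contain the complements of all fibres of [g], finitely many sets with empty
    intersection. *)
Lemma ultra_fin (I : finType) (g : R -> I) : exists i, \forall t \near U, g t = i.
Proof.
apply: contrapT => nex.
have : \forall t \near U, forall i, g t <> i.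
  by apply: filter_forall => i; apply: ultra_not => gi; apply: nex; exists i.
by move=> /filter_ex[t /(_ (g t))].
Qed.

Lemma ultra_fmap (T : Type) (g : R -> T) : UltraFilter (g @ U).
Proof.
split; first exact: fmap_proper_filter.
move=> G GP gG; apply/seteqP; split => // A GA; apply: contrapT => /ultra_not nA.
have : G (A `&` ~` A) by apply: filterI => //; exact: gG.
by rewrite setICr; exact: filter_not_empty.
Qed.

Lemma ultra_compact (T : topologicalType) (B : set T) (g : R -> T) :
  compact B -> (\forall t \near U, B (g t)) ->
  exists2 l, B l & g t @[t --> U] --> l.
Proof.
move=> + gB; rewrite compact_ultra => /(_ (g @ U) (ultra_fmap g) gB)[l [Bl gl]].
by exists l.
Qed.

Lemma norm_lim_le (W : normedModType R) (g : R -> W) l (c : R) :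
  g t @[t --> U] --> l -> (\forall t \near U, `|g t| <= c) -> `|l| <= c.
Proof.
by move=> gl gc; apply: (ler_cvg_to (cvg_norm gl) (cvg_cst c)).
Qed.

End UltraLimit.

(** * Limits of switching times and the limit signal *)

Section LimitSignal.
Variables (R : realType) (m : nat) (sg : R -> 'I_m) (tauD : R) (N0 : nat).
Hypothesis dwell : average_dwell_time tauD N0 sg.
Variable U : set_system R.
Hypotheses (U_ultra : UltraFilter U) (U_ge : forall a, \forall t \near U, a <= t).

(* The points that are limits along [U] of switching times of the translates
   [sg (t + _)]. *)
Definition limit_switching : set R := [set r | forall e, 0 < e ->
  ~ \forall t \near U, forall u, `|u - r| < e -> sg (t + u) = sg (t + r)].

(** For a single large [t], each of the disjoint balls about the [t + e i] contains a switching time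
    of [sg]; these [j] distinct times lie in []t + a, t + b[], an interval of the same length. *)
Lemma limit_switching_count a b j (e : 'I_j -> R) : a < b -> injective e ->
  (forall i, (limit_switching `&` `]a, b[) (e i)) ->
  j%:R <= N0%:R + (b - a) / tauD.
Proof.
move=> ab einj eE.
have [|r r0 sep] := exists_separation (a := a) (b := b) einj.
  by move=> i; have [_ /=] := eE i; rewrite in_itv.
have : \forall t \near U, forall i,
    ~ (forall u, `|u - e i| < r -> sg (t + u) = sg (t + e i)).
  apply: filter_forall => i; apply: ultra_not => //; have [Ei _] := eE i.
  exact: Ei.
(* [- a <= t] puts the translated interval in the half-line where the dwell-time bound applies. *)
move=> /(filterI (U_ge (- a)))/filter_ex[t [/= ta H]].
have /choice[tau Htau] : forall i, exists v,
    switching_times sg v /\ `|v - (t + e i)| < r.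
  move=> i; apply: contrapT => nsw; apply: (H i) => u ui.
  have [ai _ _] := sep i.
  apply: (@locally_constant_interval _ _ sg (t + e i - r) (t + e i + r)).
  - move=> v vi; apply: contrapT => nv; apply: nsw; exists v; split.
      by right; split => //=; lra.
    by rewrite ltr_distl.
  - by move: ui; rewrite ltr_distl; lra.
  - by lra.
have tauinj : injective tau.
  move=> i k tauik; apply: contrapT => /eqP ik.
  have [_ _ /(_ k ik)] := sep i.
  have [_ Hi] := Htau i; have [_ Hk] := Htau k.
  move: Hi Hk; rewrite -tauik !ltr_distl => Hi Hk.
  have : `|e i - e k| < 2 * r by rewrite ltr_distl; lra.
  by move=> H1 /(lt_le_trans H1); rewrite ltxx.
have [||k swk kb] := dwell (a := t + a) (b := t + b); [lra|lra|].
rewrite (_ : b - a = t + b - (t + a)); last lra.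
apply: le_trans kb; rewrite ler_nat; apply: card_ge_inj swk tauinj _ => i.
have [swi] := Htau i; rewrite ltr_distl => tr; split => //=.
by have [? ? _] := sep i; rewrite in_itv /=; apply/andP; split; lra.
Qed.

Lemma limit_switching_card a b : a < b ->
  exists2 k : nat, (limit_switching `&` `]a, b[ #= `I_k)%card &
    k%:R <= N0%:R + (b - a) / tauD.
Proof.
by move=> ab; apply: card_bounded_inj => j e einj eE;
  exact: limit_switching_count ab einj eE.
Qed.

Lemma limit_switching_finite : locally_finite limit_switching.
Proof.
move=> a b; have [ab|ba] := leP a b; last first.
  by rewrite set_itv_ge ?setI0// bnd_simp -ltNge.
have [|k Ek _] := @limit_switching_card (a - 1) (b + 1); first lra.
apply: (@sub_finite_set _ _ (limit_switching `&` `]a - 1, b + 1[)).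
  by move=> u [Eu /=]; rewrite !in_itv /= => uab; split => //; lra.
by apply/finite_setP; exists k.
Qed.

(** Eventual equality of modes along [U] is transitive in the offsets, so local constancy propagates
    along the segment by real induction. *)
Lemma limit_signal_free a b : (forall u, a < u < b -> ~ limit_switching u) ->
  forall u v, a < u < b -> a < v < b ->
  \forall t \near U, sg (t + u) = sg (t + v).
Proof.
move=> free.
have main u v : a < u -> v < b -> u <= v ->
    \forall t \near U, sg (t + u) = sg (t + v).
  move=> au vb uv.
  apply: (@interval_chain _
    (fun c d => \forall t \near U, sg (t + c) = sg (t + d))) => //.
    by move=> c d e; apply: filterS2 => t -> ->.
  move=> w wuv; have /existsNP[d /not_implyP[d0 /contrapT H]] : ~ limit_switching w.
    by apply: free; lra.
  exists d => //; split=> z zz wz; apply: filterS H => t H; [|symmetry];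
    by apply: H; rewrite ltr_distl; lra.
move=> u v uab vab; have [uv|/ltW vu] := leP u v.
  by apply: (main u v) => //; lra.
have : \forall t \near U, sg (t + v) = sg (t + u) by apply: (main v u) => //; lra.
by apply: filterS => t ->.
Qed.

(** The value at [r] is read off just to the right of [r], not from [sg (t + r)]: this makes the
    limit right-continuous at the limit switching points as well. *)
Definition limit_signal (s : R -> 'I_m) := forall r,
  exists2 d, 0 < d & forall u, r < u < r + d -> \forall t \near U, sg (t + u) = s r.

Lemma limit_signal_exists : exists s, limit_signal s.
Proof.
suff /choice : forall r, exists g, exists2 d, 0 < d &
    forall u, r < u < r + d -> \forall t \near U, sg (t + u) = g.
  by case=> s Hs; exists s.
move=> r.
have [d d0 H] := locally_finite_avoid r limit_switching_finite.
have [g Hg] := ultra_fin U_ultra (fun t => sg (t + (r + d / 2))).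
exists g, d => // u ur.
have : \forall t \near U, sg (t + u) = sg (t + (r + d / 2)).
  apply: (@limit_signal_free r (r + d)); [|lra|lra].
  by move=> w wr; apply: H; [rewrite ger0_norm; lra|rewrite gt_eqF; lra].
by apply: filterS2 Hg => t <-.
Qed.

Variable s : R -> 'I_m.
Hypothesis s_lim : limit_signal s.

Lemma limit_signal_off r : ~ limit_switching r ->
  exists2 d, 0 < d &
    \forall t \near U, forall u, `|u - r| < d -> sg (t + u) = s r.
Proof.
move=> /existsNP[e /not_implyP[e0 /contrapT He]]; have [d d0 Hd] := s_lim r.
(* The offset [r + w] lies both where [sg (t + _)] is constant and where its limit is [s r], so it
   identifies the constant. *)
have [w [w0 we wd]] := exists_lt2 e0 d0.
have : \forall t \near U, sg (t + (r + w)) = s r by apply: Hd; lra.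
move=> Hw; exists e => //; apply: filterS2 Hw He => t Hw He u ue.
by rewrite He// -Hw [RHS]He// ltr_distl; lra.
Qed.

Lemma limit_signal_near r : ~ limit_switching r ->
  exists2 d, 0 < d & forall u, `|u - r| < d -> ~ limit_switching u /\ s u = s r.
Proof.
move=> Er; have [d d0 Hd] := limit_signal_off Er.
exists d => // u ur.
have Eu : ~ limit_switching u.
  move=> /(_ (d - `|u - r|)); apply; first by rewrite subr_gt0.
  apply: filterS Hd => t H w wu; rewrite !H//.
  by have := ler_distD u w r; lra.
split => //; have [d' d'0 Hd'] := limit_signal_off Eu.
have [t [/= H /(_ u) <-]] := filter_ex (filterI Hd Hd').
  2: by rewrite subrr normr0.
by rewrite H.
Qed.

Lemma limit_signal_const a b : (forall u, a < u < b -> ~ limit_switching u) ->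
  forall u v, a < u < b -> a < v < b -> s u = s v.
Proof.
move=> free; apply: locally_constant_interval => t /free/limit_signal_near[d d0 H].
by apply/near_distP; exists d => // u /H[].
Qed.

Lemma limit_signal_right r :
  exists2 d, 0 < d & forall u, r < u < r + d -> ~ limit_switching u /\ s u = s r.
Proof.
have [d d0 Hd] := s_lim r.
have [d' d'0 Hd'] := locally_finite_avoid r limit_switching_finite.
have [w [w0 wd wd']] := exists_lt2 d0 d'0.
exists w => // u ur; have Eu : ~ limit_switching u.
  by apply: Hd'; [rewrite ger0_norm; lra|rewrite gt_eqF; lra].
split => //; have [d1 d10 Hd1] := limit_signal_off Eu.
have Hu : \forall t \near U, sg (t + u) = s r by apply: Hd; lra.
have [t [/= <- /(_ u) <-//]] := filter_ex (filterI Hu Hd1).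
by rewrite subrr normr0.
Qed.

Lemma limit_signal_left r : exists2 d, 0 < d &
  exists g, forall u, r - d < u < r -> ~ limit_switching u /\ s u = g.
Proof.
have [d d0 Hd] := locally_finite_avoid r limit_switching_finite.
have free u : r - d < u < r -> ~ limit_switching u.
  by move=> ur; apply: Hd; [rewrite ler0_norm; lra|rewrite lt_eqF; lra].
exists d => //; exists (s (r - d / 2)) => u ur; split; first exact: free.
by apply: (limit_signal_const free); lra.
Qed.

(** Restricted to positive times, since [0] is always counted as a switching time; the open
    intervals of the dwell-time bound exclude it. *)
Lemma limit_signal_switching t : switching_times s t -> 0 < t -> limit_switching t.
Proof.
move=> [->|[_ nt] t0]; first by rewrite ltxx.
apply: contrapT => /limit_signal_near[d d0 H]; apply: nt.
by apply/near_distP; exists d => // u /H[].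
Qed.

Lemma limit_signal_is_switching_signal : switching_signal s.
Proof.
split.
  exists limit_switching => [|a b _ free u v]; first exact: limit_switching_finite.
  rewrite !in_itv /=; apply: limit_signal_const => w wab Ew.
  by have := free w Ew; rewrite in_itv /= wab.
move=> t _; have [d d0 H] := limit_signal_right t.
by apply/near_rightP; exists d => // u /H[].
Qed.

Lemma limit_signal_dwell : average_dwell_time tauD N0 s.
Proof.
move=> a b a0 ab; apply: card_bounded_inj => j e einj eE.
apply: (limit_switching_count ab einj) => i; have [sw] := eE i.
rewrite /= in_itv /= => eab; split => //.
by apply: limit_signal_switching => //; lra.
Qed.

End LimitSignal.

(** * Differentiability within a domain and in two-sided form *)

Section Derivatives.
Variables (R : realType) (n : nat).
Implicit Types (x : R -> 'rV[R]_n) (I : set R) (t u : R).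

Lemma difference_quotientE x t u v : u != t ->
  `|x u - x t - (u - t) *: v| =
  `|v - (u - t)^-1 *: (x u - x t)| * `|u - t|.
Proof.
rewrite -subr_eq0 => ut; rewrite mulrC -normrZ scalerBr scalerA divff//.
by rewrite scale1r distrC.
Qed.

Lemma has_deriv_within I x t v : has_deriv x t v -> derivative_within I x t v.
Proof.
move=> xder; apply/cvgrPdist_le => e e0.
apply: filterS (xder e e0) => u H ut _.
by move: H; rewrite difference_quotientE// ler_pM2r// normr_gt0 subr_eq0.
Qed.

Lemma derivative_within_near I x t v : (\forall u \near t, I u) ->
  derivative_within I x t v -> has_deriv x t v.
Proof.
move=> It /cvgrPdist_le xder e e0.
have /near_distP[d d0 H] := xder e e0; have /near_distP[d' d'0 H'] := It.
have [w [w0 wd wd']] := exists_lt2 d0 d'0.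
apply/near_distP; exists w => // u uw; have [->|ut] := eqVneq u t.
  by rewrite !subrr scale0r subr0 !normr0 mulr0.
rewrite difference_quotientE// ler_pM2r ?normr_gt0 ?subr_eq0//.
by apply: H => //; [apply: lt_trans wd|apply: H'; apply: lt_trans wd'].
Qed.

Lemma has_deriv_two_sided x t v :
  (forall e, 0 < e -> exists2 d, 0 < d & forall a b, a <= b ->
     `|a - t| < d -> `|b - t| < d ->
     `|x b - x a - (b - a) *: v| <= e * (b - a)) ->
  has_deriv x t v.
Proof.
move=> H e /H[d d0 {}H]; apply/near_distP; exists d => // u ut.
have tt : `|t - t| < d by rewrite subrr normr0.
have [tu|/ltW tu] := leP t u.
  by rewrite [`|u - t|]ger0_norm ?subr_ge0//; exact: H.
rewrite [`|u - t|]distrC [`|t - u|]ger0_norm ?subr_ge0//.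
rewrite (_ : x u - _ - _ = - (x t - x u - (t - u) *: v)).
  by rewrite normrN; exact: H.
by rewrite -(opprB u t) scaleNr opprK opprD opprB.
Qed.

End Derivatives.

(** * The limit curve solves the limit equation *)

Section LimitCurve.
Variables (R : realType) (n m : nat) (f : 'I_m -> 'rV[R]_n -> 'rV[R]_n).
Hypothesis f_cont : forall g, continuous (f g).
Variables (x : R -> 'rV[R]_n) (sg : R -> 'I_m) (tauD : R) (N0 : nat) (L : R).
Hypotheses (dwell : average_dwell_time tauD N0 sg) (L_ge0 : 0 <= L).
Hypothesis x_lip :
  forall t u, 0 <= t -> 0 <= u -> `|x u - x t| <= L * `|u - t|.
Hypothesis x_der : forall t, 0 < t -> ~ switching_times sg t ->
  has_deriv x t (f (sg t) (x t)).
Variable U : set_system R.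
Hypotheses (U_ultra : UltraFilter U) (U_ge : forall a, \forall t \near U, a <= t).
Variables (y : R -> 'rV[R]_n) (s : R -> 'I_m).
Hypotheses (y_lim : forall r, x (t + r) @[t --> U] --> y r)
  (s_lim : limit_signal sg U s).

Lemma limit_curve_lip t u : `|y u - y t| <= L * `|u - t|.
Proof.
apply: (norm_lim_le U_ultra (cvgB (@y_lim u) (@y_lim t))).
apply: filterS2 (U_ge (- u)) (U_ge (- t)) => w wu wt /=.
apply: le_trans (x_lip _ _) _; [lra|lra|].
by rewrite (_ : w + u - (w + t) = u - t)//; lra.
Qed.

Lemma field_near g r e : 0 < e -> exists2 d, 0 < d &
  forall z, `|z - y r| < d -> `|f g z - f g (y r)| < e.
Proof.
move=> e0; have /cvgrPdist_lt/(_ e e0)/nbhs_normP[d /= d0 H] := @f_cont g (y r).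
by exists d => // z zd; rewrite distrC; apply: H; rewrite /ball_ /= distrC.
Qed.

Lemma lip_radius d : 0 < d -> exists2 w, 0 < w & L * w < d.
Proof.
move=> d0; have L1 : 0 < L + 1 by rewrite ltr_wpDl.
(* [L + 1] keeps the denominator positive when [L = 0]. *)
exists (d / (L + 1)); first exact: divr_gt0.
by rewrite mulrA ltr_pdivrMr// mulrC ltr_pM2l// ltrDl.
Qed.

Lemma limit_curve_continuous : continuous y.
Proof.
move=> t; apply/cvgrPdist_lt => e e0; have [w w0 Lw] := lip_radius e0.
apply/near_distP; exists w => // u ut; rewrite distrC.
apply/(le_lt_trans (limit_curve_lip _ _))/(le_lt_trans _ Lw).
by apply: ler_wpM2l => //; exact: ltW.
Qed.

(** For [U]-many [t] the mode is [s r] on []t + a, t + b[] and [x] stays within [rho] of [y r], so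
    its velocity is within [e] of [f (s r) (y r)]; the mean value inequality for [x] then passes to
    the limit. *)
Lemma limit_curve_deriv_off r : ~ limit_switching sg U r ->
  has_deriv y r (f (s r) (y r)).
Proof.
move=> Er; apply: has_deriv_two_sided => e e0.
have [rho rho0 Hrho] := field_near (s r) r e0.
have [d d0 Hd] := limit_signal_off U_ultra s_lim Er.
have [w w0 Lw] := @lip_radius (rho / 2) ltac:(lra).
have [q [q0 qd qw]] := exists_lt2 d0 w0.
exists q => // a b ab; rewrite !ltr_distl => /andP[ra ar] /andP[rb br].
apply: (norm_lim_le U_ultra).
  by apply: cvgB; [exact: cvgB (@y_lim b) (@y_lim a)|exact: cvg_cst].
(* Half of [rho] is for the distance of [x (t + r)] to its limit, half for the motion of [x] within
   [w] of the time [t + r]. *)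
have near_x : \forall t \near U, `|x (t + r) - y r| < rho / 2.
  have /cvgrPdist_lt/(_ (rho / 2)) := @y_lim r.
  by under eq_near do rewrite distrC; apply; lra.
near=> t; have tr : q - r <= t by near: t; exact: U_ge.
rewrite (_ : b - a = t + b - (t + a)); last lra.
apply: (@mean_value_inequality _ _ x set0); [lra|lra|..].
- by move=> ? ?; rewrite set0I; exact: finite_set0.
(* The bounds [q - r <= t] and [r - q < a] make [t + a] positive, where the hypotheses on [x]
   apply. *)
- apply: (@within_continuous_lip _ _ _ _ L) => z z' /=.
  by rewrite !in_itv /= => ? ?; apply: x_lip; lra.
have sg_itv u : t + a < u < t + b -> sg u = s r.
  move=> uab; rewrite (_ : u = t + (u - t)); last lra.
  have : `|u - t - r| < d by rewrite ltr_distl; lra.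
  by move: (u - t); near: t.
move=> z zab _; exists (f (sg z) (x z)).
  apply: x_der; first lra.
  case=> [/= z0|[_]]; first lra.
  apply; apply/near_distP.
  have [||w' [w'0 w'a w'b]] := @exists_lt2 _ (z - (t + a)) (t + b - z);
    [lra|lra|].
  exists w' => // u; rewrite ltr_distl => uz; rewrite !sg_itv//; lra.
rewrite sg_itv//; apply: Hrho.
have xz : `|x z - x (t + r)| <= L * w.
  apply: le_trans (x_lip _ _) _; [lra|lra|].
  by apply: ler_wpM2l => //; rewrite ltW// ltr_distl; lra.
have xr : `|x (t + r) - y r| < rho / 2 by near: t.
by have := ler_distD (x (t + r)) (x z) (y r); lra.
Unshelve. all: by end_near.
Qed.

(** A limit switching point where [s] does not jump escapes [limit_curve_deriv_off]; the mean value
    inequality for [y], with such points exceptional, supplies the derivative there. *)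
Lemma limit_curve_deriv r : (\forall u \near r, s u = s r) ->
  has_deriv y r (f (s r) (y r)).
Proof.
move=> /near_distP[d d0 Hd]; apply: has_deriv_two_sided => e e0.
have [rho rho0 Hrho] := field_near (s r) r e0.
have [w w0 Lw] := lip_radius rho0.
have [q [q0 qd qw]] := exists_lt2 d0 w0.
exists q => // a b ab; rewrite !ltr_distl => /andP[ra ar] /andP[rb br].
apply: (@mean_value_inequality _ _ y (limit_switching sg U)); [lra|lra|..].
- exact (limit_switching_finite dwell U_ultra U_ge).
- exact: continuous_subspaceT limit_curve_continuous.
move=> t tab Et; exists (f (s t) (y t)); first exact: limit_curve_deriv_off.
rewrite Hd; last by rewrite ltr_distl; lra.
apply/Hrho/(le_lt_trans (limit_curve_lip _ _))/(le_lt_trans _ Lw).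
by apply: ler_wpM2l => //; rewrite ltW// ltr_distl; lra.
Qed.

Lemma time_domain_unbounded : time_domain [set t : R | 0 <= t].
Proof.
left; exists +oo%E => //.
by apply/seteqP; split=> t /=; [rewrite ltry|case].
Qed.

Lemma limit_curve_solution : solution f s [set t | 0 <= t] y.
Proof.
have s_near t : ~ limit_switching sg U t -> \forall u \near t, s u = s t.
  move=> /(limit_signal_near U_ultra s_lim)[d d0 H].
  by apply/near_distP; exists d => // u /H[].
have fy_cont g t : f g (y u) @[u --> t] --> f g (y t).
  by apply: continuous_comp; [exact: limit_curve_continuous|exact: f_cont].
(* Common source of the continuity and of the one-sided limits of the velocity: along [F] the mode
   is frozen at [g]. *)
have cvg_eq (F : set_system R) t g : Filter F -> F `=>` nbhs t ->
    (\forall u \near F, s u = g) -> f (s u) (y u) @[u --> F] --> f g (y t).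
  move=> FF Ft Fg; apply: (@cvg_trans _ (f g (y u) @[u --> F])).
    by apply: near_eq_cvg; apply: filterS Fg => u ->.
  exact: cvg_trans (cvg_app _ Ft) (fy_cont g t).
split; first exact: time_domain_unbounded.
- split; first exact: continuous_subspaceT limit_curve_continuous.
  exists (limit_switching sg U), (fun t => f (s t) (y t)); split.
  + exact (limit_switching_finite dwell U_ultra U_ge).
  + by move=> t [_ /s_near/limit_curve_deriv]; exact: has_deriv_within.
  + apply/subspace_continuousP => t [_ /s_near st]; apply: cvg_eq.
      exact: cvg_within.
    exact: cvg_within st.
  + move=> t _; split.
      have [d d0 [g H]] := limit_signal_left dwell U_ultra U_ge s_lim t.
      exists (f g (y t)); apply: cvg_eq.
        by apply: cvg_trans (cvg_within _) _; exact: cvg_within.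
      by apply: cvg_within; apply/near_leftP; exists d => // u /H[].
    have [d d0 H] := limit_signal_right dwell U_ultra U_ge s_lim t.
    exists (f (s t) (y t)); apply: cvg_eq.
      by apply: cvg_trans (cvg_within _) _; exact: cvg_within.
    by apply: cvg_within; apply/near_rightP; exists d => // u /H[].
move=> t t0 nsw; apply/has_deriv_within/limit_curve_deriv.
apply: contrapT => nst; apply: nsw; have [t0'|] := eqVneq t 0; first by left.
by move=> tn; right; split => //; rewrite lt_neqAle eq_sym tn.
Qed.

End LimitCurve.

(** Serves for [V], which is continuous relative to [Omega] only: the limit is taken through
    [within D (nbhs z)]. *)
Lemma cvg_comp_within (S : Type) (X Y : topologicalType) (F : set_system S)
  {FF : Filter F} (g : S -> X) (h : X -> Y) (D : set X) z :
  {within D, continuous h} -> D z -> (\forall t \near F, D (g t)) ->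
  g t @[t --> F] --> z -> h (g t) @[t --> F] --> h z.
Proof.
move=> /subspace_continuousP hc Dz FD gz.
apply: (@cvg_comp _ _ _ g h F (within D (nbhs z))); last exact: hc.
by move=> A zA; apply: filterS2 (gz _ zA) FD => t; exact.
Qed.

(** * Limit trajectories of a bounded trajectory *)

Section BoundedTrajectory.
Variables (R : realType) (n m : nat) (f : 'I_m -> 'rV[R]_n -> 'rV[R]_n).
Hypothesis f_cont : forall g, continuous (f g).
Variables (chi : 'I_m -> set 'rV[R]_n) (Omega : set 'rV[R]_n).
Hypothesis chi_closed : forall g, closed (chi g).
Variable V : 'rV[R]_n -> 'I_m -> R.
Hypothesis V_cont : forall g, {within Omega, continuous (V ^~ g)}.
Variables (tauD : R) (N0 : nat) (p : trajectory R n m) (B : set 'rV[R]_n).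
Hypothesis p_in : (trajectories_V f Omega V `&` trajectories_in f chi `&`
  dwell_time_trajectories f tauD N0) p.
Hypotheses (B_compact : compact B) (B_Omega : B `<=` Omega).
Hypothesis p_B : forall t, 0 <= t -> domain p t /\ B (curve p t).

Let x := curve p.
Let sg := signal p.

Lemma bounded_domain t : 0 <= t -> domain p t.
Proof. by move=> /p_B[]. Qed.

Lemma bounded_in t : 0 <= t -> B (x t).
Proof. by move=> /p_B[]. Qed.

Lemma bounded_dwell : average_dwell_time tauD N0 sg.
Proof. by have [_ []] := p_in. Qed.

Lemma bounded_switching_finite : locally_finite (switching_times sg).
Proof.
move=> a b; have b1 : 0 < `|b| + 1 by rewrite ltr_wpDl.
have [k swk _] := bounded_dwell (lexx 0) b1.
apply: (@sub_finite_set _ _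
  ([set 0] `|` (switching_times sg `&` `]0, (`|b| + 1)[))).
  move=> t [[->|[t0 nt]] /=]; first by left.
  rewrite in_itv /= => /andP[_ tb]; right; split; first by right.
  by rewrite /= in_itv /= t0 (le_lt_trans tb)// (le_lt_trans (ler_norm b))// ltrDl.
by rewrite finite_setU; split; [exact: finite_set1|apply/finite_setP; exists k].
Qed.

Lemma bounded_deriv t : 0 < t -> ~ switching_times sg t ->
  has_deriv x t (f (sg t) (x t)).
Proof.
have [[_ [[_ [[_ _ px] _]] _]] _] := p_in; move=> t0 nsw.
apply: (derivative_within_near (I := domain p)).
  apply/near_distP; exists t => // u; rewrite ltr_distl => ut.
  by apply: bounded_domain; lra.
by apply: px nsw; exact/bounded_domain/ltW.
Qed.

(** The finitely many fields share a bound on the compact [B]; the mean value inequality with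
    [v = 0] turns it into a Lipschitz constant. *)
Lemma bounded_lip : exists2 L, 0 <= L &
  forall t u, 0 <= t -> 0 <= u -> `|x u - x t| <= L * `|u - t|.
Proof.
have : \forall M \near +oo, forall g z, B z -> `|f g z| <= M.
  apply: filter_forall => g.
  have /compact_bounded : compact (f g @` B).
    by apply: continuous_compact => //; exact: continuous_subspaceT.
  rewrite /bounded_set /bounded_near; apply: filterS => M H z Bz.
  by apply: H; exists z.
move=> /(filterI (nbhs_pinfty_ge (num_real 0)))/filter_ex[M [/= M0 HM]].
have M1 : 0 <= M + 1 by lra.
(* [M + 1] rather than [M]: the mean value inequality asks for a strict bound on the derivatives. *)
exists (M + 1) => // t u.
wlog tu : t u / t <= u.
  move=> H; have [tu|/ltW ut] := leP t u; first exact: H.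
  by move=> t0 u0; rewrite distrC [`|u - t|]distrC; exact: H.
move=> t0 u0; rewrite [`|u - t|]ger0_norm ?subr_ge0//.
rewrite -[x u - x t]subr0 -(scaler0 _ (u - t)).
apply: mean_value_inequality => //; first exact: bounded_switching_finite.
  have [[_ [[_ [[_ [+ _] _] _]] _]] _] := p_in; apply: continuous_subspaceW.
  by move=> v /=; rewrite in_itv /= => tv; apply: bounded_domain; lra.
move=> v tv nsw; exists (f (sg v) (x v)); first by apply: bounded_deriv => //; lra.
rewrite subr0; apply: (@le_lt_trans _ _ M); last by lra.
by apply: HM; apply: bounded_in; lra.
Qed.

Lemma time_domain_ge0 (J : set R) t : time_domain J -> J t -> 0 <= t.
Proof.
by case=> [[T _ ->] []//|[T _ ->]]; rewrite /= in_itv /= => /andP[].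
Qed.

Section Limit.
Variable U : set_system R.
Hypotheses (U_ultra : UltraFilter U) (U_ge : forall a, \forall t \near U, a <= t).
Variables (y : R -> 'rV[R]_n) (s : R -> 'I_m).
Hypotheses (y_lim : forall r, x (t + r) @[t --> U] --> y r)
  (s_lim : limit_signal sg U s).

Lemma limit_curve_in r : B (y r).
Proof.
have B_closed := compact_closed (@norm_hausdorff _ _) B_compact.
apply: (closed_cvg _ B_closed _ _ (@y_lim r)).
by apply: filterS (U_ge (- r)) => t tr; apply: bounded_in; lra.
Qed.

Lemma limit_signal_at r : ~ limit_switching sg U r ->
  \forall t \near U, 0 <= t + r /\ sg (t + r) = s r.
Proof.
move=> /(limit_signal_off U_ultra s_lim)[d d0].
apply: filterS2 (U_ge (- r)) => t tr.
by move=> H; split; [lra|apply: H; rewrite subrr normr0].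
Qed.

Lemma limit_near_right r :
  \forall u \near r^'+, ~ limit_switching sg U u /\ s u = s r.
Proof.
have [d d0 H] := limit_signal_right bounded_dwell U_ultra U_ge s_lim r.
by apply/near_rightP; exists d.
Qed.

Lemma limit_curve_cvg r : y u @[u --> r^'+] --> y r.
Proof.
have [L L0 x_lip] := bounded_lip.
have y_cont := limit_curve_continuous L0 x_lip U_ultra U_ge y_lim.
exact/cvg_at_right_filter/y_cont.
Qed.

(** Off the limit switching points, closedness of [chi] passes to the limit along [U]; every [r] is
    then approached from the right through such points, where [s] keeps the value [s r]. *)
Lemma limit_chi r : chi (s r) (y r).
Proof.
apply: (closed_cvg _ (@chi_closed (s r)) _ _ (@limit_curve_cvg r)).
apply: filterS (limit_near_right r) => u [Eu <-].
apply: (closed_cvg _ (@chi_closed (s u)) _ _ (@y_lim u)).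
apply: filterS (limit_signal_at Eu) => t [tu <-].
by have [[_ [_ H]] _] := p_in; exact/H/bounded_domain.
Qed.

(** This holds for either order of [a] and [b]: with [t] fixed, [t'] is so large that
    [t + a <= t' + b], and the limit is taken first in [t'], then in [t]. *)
Lemma limit_V_le a b : ~ limit_switching sg U a -> ~ limit_switching sg U b ->
  s a = s b -> V (y b) (s b) <= V (y a) (s a).
Proof.
move=> Ea Eb sab.
have V_lim r : V (x (t + r)) (s a) @[t --> U] --> V (y r) (s a).
  apply: (cvg_comp_within (h := V ^~ (s a)) (D := Omega)) (@y_lim r).
  - exact: V_cont.
  - by apply: B_Omega; exact: limit_curve_in.
  - by apply: filterS (U_ge (- r)) => t tr; apply/B_Omega/bounded_in; lra.
rewrite -sab; apply: (closed_cvg _ (@closed_ge _ _) _ _ (V_lim a)).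
apply: filterS (limit_signal_at Ea) => t [ta sga].
apply: (closed_cvg _ (@closed_le _ _) _ _ (V_lim b)).
apply: filterS2 (limit_signal_at Eb) (U_ge (t + a - b)) => t' [tb sgb] tt'.
have [[[_ _ mono] _] _] := p_in.
have := mono (t + a) (t' + b); rewrite -/sg -/x sga sgb -sab; apply => //.
- exact: bounded_domain.
- exact: bounded_domain.
- lra.
Qed.

(** Right limits extend [limit_V_le] to all offsets, and exchanging the two offsets gives
    equality. *)
Lemma limit_V_eq a b : s a = s b -> V (y a) (s a) = V (y b) (s b).
Proof.
have V_right g r : V (y u) g @[u --> r^'+] --> V (y r) g.
  apply: (cvg_comp_within (h := V ^~ g) (D := Omega)) (@limit_curve_cvg r).
  - exact: V_cont.
  - by apply: B_Omega; exact: limit_curve_in.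
  - by apply: nearW => u; apply: B_Omega; exact: limit_curve_in.
suff le c d : s c = s d -> V (y d) (s d) <= V (y c) (s c).
  by move=> ab; apply/eqP; rewrite eq_le !le.
move=> cd; apply: (closed_cvg _ (@closed_ge _ _) _ _ (V_right (s c) c)).
apply: filterS (limit_near_right c) => u [Eu suc].
apply: (closed_cvg _ (@closed_le _ _) _ _ (V_right (s d) d)).
apply: filterS (limit_near_right d) => v [Ev svd].
by rewrite -suc -svd; apply: limit_V_le => //; rewrite suc svd.
Qed.

Lemma limit_trajectory_in :
  (trajectories_V_star f Omega V `&` trajectories_in f chi `&`
   dwell_time_trajectories f tauD N0) (Trajectory y s [set t | 0 <= t]).
Proof.
have max : maximal_trajectories f (Trajectory y s [set t | 0 <= t]).
  split.
    exact: (limit_signal_is_switching_signal bounded_dwell U_ultra U_ge).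
  split.
    have [L L0 x_lip] := bounded_lip.
    exact: (limit_curve_solution f_cont bounded_dwell L0 x_lip bounded_deriv
      U_ultra U_ge y_lim s_lim).
  (* Maximality: every time domain lies in the half-line, so nothing extends it. *)
  move=> J z [Jdom _ _] IJ _; apply/seteqP; split => // t Jt.
  exact: time_domain_ge0 Jdom Jt.
split; [split|]; split => //.
- split => // [t _|t t' _ _ _ /= tt'].
    by apply: B_Omega; exact: limit_curve_in.
  by rewrite (limit_V_eq tt').
- by move=> t t' _ _ /= /limit_V_eq.
- by move=> t _; exact: limit_chi.
- exact: (limit_signal_dwell bounded_dwell U_ultra U_ge s_lim).
Qed.

End Limit.

Lemma limit_pair_exists (U : set_system R) : UltraFilter U ->
  (forall a, \forall t \near U, a <= t) ->
  exists (y : R -> 'rV[R]_n) s,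
    (forall r, x (t + r) @[t --> U] --> y r) /\ limit_signal sg U s.
Proof.
move=> U_ultra U_ge.
have [s s_lim] := limit_signal_exists bounded_dwell U_ultra U_ge.
suff /choice[y y_lim] : forall r, exists l : 'rV[R]_n, x (t + r) @[t --> U] --> l.
  by exists y, s.
move=> r; have [|l _ Hl] :=
    ultra_compact U_ultra (g := fun t => x (t + r)) B_compact.
  by apply: filterS (U_ge (- r)) => t tr; apply: bounded_in; lra.
by exists l.
Qed.

Lemma limit_weakly_invariant (U : set_system R) (y : R -> 'rV[R]_n) s :
  UltraFilter U ->
  (forall a, \forall t \near U, a <= t) ->
  (forall r, x (t + r) @[t --> U] --> y r) -> limit_signal sg U s ->
  weakly_invariant
    (trajectories_V_star f Omega V `&` trajectories_in f chi `&`
     dwell_time_trajectories f tauD N0)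
    [set (y r, s r) | r in [set r | 0 <= r]] /\
  [set (y r, s r) | r in [set r | 0 <= r]] `<=` Omega `*` [set: 'I_m].
Proof.
move=> U_ultra U_ge y_lim s_lim; split; last first.
  move=> _ [r _ <-]; split => //=; apply: B_Omega.
  exact: (limit_curve_in U_ultra U_ge y_lim).
split; first by exists (y 0, s 0), 0 => //=.
move=> xi g [r r0 [<- <-]].
exists (Trajectory (fun t => y (r + t)) (fun t => s (r + t)) [set t | 0 <= t]).
  (* The translate by [r] of the limit pair is a limit pair along the image of [U] under
     [t |-> t + r]. *)
  apply: (@limit_trajectory_in ((fun t => t + r) @ U)).
  - exact: ultra_fmap.
  - move=> a; have := U_ge (a - r); apply: filterS => t; rewrite /=; lra.
  - move=> t; rewrite /=.
    have := @y_lim (r + t); under eq_fun do rewrite addrA.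
    done.
  - move=> t; have [d d0 H] := s_lim (r + t); exists d => // u tu.
    have : \forall w \near U, sg (w + (r + u)) = s (r + t) by apply: H; lra.
    by apply: filterS => w; rewrite addrA.
split => /=; [by rewrite addr0..|].
by move=> t t0; exists (r + t) => //; exact: addr_ge0.
Qed.

End BoundedTrajectory.

(** * Convergence to the largest weakly invariant set *)

Lemma euclidean_norm_le (R : realType) (n : nat) (u : 'rV[R]_n) :
  euclidean_norm u <= Num.sqrt n%:R * `|u|.
Proof.
rewrite -[X in _ * X]ger0_norm// -sqrtr_sqr -sqrtrM//; apply: ler_wsqrtr.
apply: (@le_trans _ _ (\sum_(i < n) `|u| ^+ 2)).
  apply: ler_sum => i _; rewrite -[X in X <= _]ger0_norm ?sqr_ge0// normrX.
  rewrite lerXn2r ?nnegrE//.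
  rewrite /Num.norm /= mx_normrE.
  exact: (le_bigmax _ (fun ij : 'I_1 * 'I_n => `|u ij.1 ij.2|) (ord0, i)).
by rewrite sumr_const card_ord mulr_natl.
Qed.

Theorem theorem2p4 (R : realType) (n m : nat)
  (f : 'I_m -> 'rV[R]_n -> 'rV[R]_n)
  (f_cont : forall g, continuous (f g))
  (chi : 'I_m -> set 'rV[R]_n) (chi_cov : closed_covering chi)
  (Omega : set 'rV[R]_n) (Omega_open : open Omega)
  (V : 'rV[R]_n -> 'I_m -> R)
  (V_cont : forall g, {within Omega, continuous (V ^~ g)})
  (tauD : R) (tauD_gt0 : 0 < tauD) (N0 : nat) (N0_gt0 : (0 < N0)%N)
  (p : trajectory R n m)
  (p_in : (trajectories_V f Omega V `&` trajectories_in f chi `&`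
           dwell_time_trajectories f tauD N0) p)
  (B : set 'rV[R]_n) (B_compact : compact B) (B_Omega : B `<=` Omega)
  (p_B : forall t, 0 <= t -> domain p t /\ B (curve p t)) :
  exists M : set ('rV[R]_n * 'I_m),
    largest_weakly_invariant
      (trajectories_V_star f Omega V `&` trajectories_in f chi `&`
       dwell_time_trajectories f tauD N0)
      (Omega `*` [set: 'I_m]) M /\
    converges_to_set (curve p) (fst @` M).
Proof.
have [chi_closed _] := chi_cov.
pose TT := trajectories_V_star f Omega V `&` trajectories_in f chi `&`
  dwell_time_trajectories f tauD N0.
pose D := Omega `*` [set: 'I_m].
(* The union of all weakly invariant sets inside [D] is itself weakly invariant once nonempty, hence
   the largest; limit trajectories provide a point of it. *)
pose M : set ('rV[R]_n * 'I_m) := [set z | exists2 M',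
  weakly_invariant TT M' /\ M' `<=` D & M' z].
have limit U : UltraFilter U -> (forall a, \forall t \near U, a <= t) ->
    exists2 xi, curve p t @[t --> U] --> xi & (fst @` M) xi.
  move=> UU U_ge.
  have [y [s [y_lim s_lim]]] := limit_pair_exists p_in B_compact p_B UU U_ge.
  have MU := limit_weakly_invariant f_cont chi_closed V_cont p_in B_compact
    B_Omega p_B UU U_ge y_lim s_lim.
  exists (y 0); first by have := @y_lim 0; under eq_fun do rewrite addr0.
  by exists (y 0, s 0) => //; eexists; [exact: MU|exists 0 => //=].
have pinfty_ge (G : set_system R) : Filter G -> (+oo : set_system R) `<=` G ->
    forall a : R, \forall t \near G, a <= t.
  by move=> FG ooG a; exact: (ooG _ (nbhs_pinfty_ge (num_real a))).
exists M; split.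
  split.
  - split.
      have [U [UU ooU]] := ultraFilterLemma (F := (+oo : set_system R)) _.
      by have [_ _ [z Mz _]] := limit U UU (pinfty_ge _ _ ooU); exists z.
    move=> xi g [M' [[M'n M'inv] M'D] M'z].
    have [q qTT [q0 qs qM]] := M'inv xi g M'z.
    by exists q => //; split=> // t qt; exists M'; [split|exact: qM].
  - by move=> z [M' [_ M'D] /M'D].
  - by move=> M' M'inv M'D z M'z; exists M'.
have dist_ge0 t : (0 <= distance_to (curve p t) (fst @` M))%E.
  by apply/ereal_infP => _ [a _ <-]; rewrite lee_fin sqrtr_ge0.
have dist_lt e : 0 < e ->
    \forall t \near +oo, (distance_to (curve p t) (fst @` M) < e%:E)%E.
  move=> e0; apply: contrapT => nfar.
  pose A := [set t | ~ (distance_to (curve p t) (fst @` M) < e%:E)%E].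
  have AF : ProperFilter (within A (+oo : set_system R)).
    split; last exact: within_filter.
    move=> AF; apply: nfar; have : \forall t \near +oo, ~ A t := AF.
    by apply: filterS => t; exact: contrapT.
  have [U [UU AU]] := ultraFilterLemma AF.
  have U_ge : forall a, \forall t \near U, a <= t.
    by apply: pinfty_ge => S ooS; apply/AU/(filterS _ ooS) => t St _.
  have UA : U A by apply: AU; apply: nearW.
  have [xi xlim Mxi] := limit U UU U_ge.
  (* [Num.sqrt n%:R] compares the Euclidean norm with the sup norm; adding [1] avoids a zero
     denominator when [n = 0]. *)
  have sn : 0 < Num.sqrt n%:R + 1 :> R by rewrite ltr_wpDl// sqrtr_ge0.
  have : 0 < e / (Num.sqrt n%:R + 1) by exact: divr_gt0.
  move=> /((cvgrPdist_lt _ _).1 xlim)/(filterI UA)/filter_ex[t [/= nAt xt]].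
  apply: nAt; apply: (@le_lt_trans _ _ (euclidean_norm (curve p t - xi))%:E).
    by apply: ereal_inf_lbound; exists xi.
  rewrite lte_fin; apply: le_lt_trans (euclidean_norm_le _) _.
  rewrite distrC; move: xt; rewrite ltr_pdivlMr// mulrC; apply: le_lt_trans.
  by rewrite ler_wpM2r// lerDl.
(* The distance is extended-real: eventual finiteness comes from the bound with [e = 1], and the
   real values are then compared with [e]. *)
apply/fine_cvgP; split.
  apply: filterS (dist_lt 1 ltr01) => t lt1.
  by rewrite ge0_fin_numE ?dist_ge0// (lt_trans lt1)// ltry.
apply/cvgrPdist_lt => e e0; apply: filterS (dist_lt e e0) => t lte /=.
rewrite sub0r normrN ger0_norm ?fine_ge0// -lte_fin fineK//.
by rewrite ge0_fin_numE ?dist_ge0// (lt_trans lte)// ltry.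
Qed.
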